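(* Let $\mathcal H$ be a finite-dimensional real Hilbert space, $\mathcal A:\mathcal H\to 2^{\mathcal H}$ a maximally monotone operator, $\mathcal Q$ a linear operator on $\mathcal H$, and $\mathcal T:=(\mathcal A+\mathcal Q)^{-1}\mathcal Q$. Let $b^0\in\mathcal H$ and let $\{b^k\}_{k\in\mathbb N}$ be generated by $b^{k+1}:=\mathcal Tb^k$. If $\mathcal Q$ is symmetric and positive definite, then the following hold. (i) $\mathcal T$ is $\mathcal Q$-asymptotically regular. (ii) (Basic convergence) There exists $b^\star\in\operatorname{zer}\mathcal A$ such that $b^k\to b^\star$ as $k\to\infty$. (iii) (Sequential error) $\|b^{k+1}-b^k\|_{\mathcal Q}$ has the pointwise sublinear convergence rate $\mathcal O(1/\sqrt k)$: with $b^\star$ as in (ii), $$\|b^{k+1}-b^k\|_{\mathcal Q}\le\frac{1}{\sqrt{k+1}}\,\|b^0-b^\star\|_{\mathcal Q},\qquad\forall k\in\mathbb N .$$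
   Context: $\mathbb N=\{0,1,2,\dots\}$. $\|a\|_{\mathcal Q}:=\sqrt{\langle\mathcal Qa|a\rangle}$ for symmetric positive definite $\mathcal Q$. $\operatorname{zer}\mathcal A:=\{b\in\mathcal H:0\in\mathcal Ab\}$. $a=\mathcal Tb$ means $\mathcal Qb\in\mathcal Aa+\mathcal Qa$. $\mathcal T$ is $\mathcal Q$-asymptotically regular if $\|\mathcal T^{k+1}b-\mathcal T^kb\|_{\mathcal Q}\to0$ as $k\to\infty$ for every $b\in\mathcal H$.
   Formalization: The formal statement adds the assumption that zer A is nonempty; without it the claim fails (H = ℝ, Ax = {1}, Q = id gives Tb = b − 1, so steps have norm 1 and no zero exists), and (ii) itself forces it. *)

(* Defs.v *)
From HB Require Import structures.
From mathcomp Require Import all_boot all_order all_algebra.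
From mathcomp Require Import all_classical all_reals all_analysis.

Set Implicit Arguments.
Unset Strict Implicit.
Unset Printing Implicit Defensive.

Import Order.TTheory GRing.Theory Num.Theory.
Import numFieldNormedType.Exports.

Local Open Scope classical_set_scope.
Local Open Scope ring_scope.

(* A finite-dimensional real Hilbert space is a [vectType R], with [R] a
   [realType], together with an inner product [{dot H for idfun}]. *)
Section Hilbert.
Variables (R : realType) (H : vectType R) (ip : {dot H for idfun}).

Definition symmetric_op (Q : {linear H -> H}) : Prop :=
  forall x y : H, ip (Q x) y = ip x (Q y).

Definition posdef_op (Q : {linear H -> H}) : Prop :=
  forall x : H, x != 0 -> 0 < ip (Q x) x.

Definition hnorm (x : H) : R := Num.sqrt (ip x x).

Definition qnorm (Q : {linear H -> H}) (x : H) : R := Num.sqrt (ip (Q x) x).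

(* Convergence for the Hilbert norm; a bare [vectType] carries no topology. *)
Definition hcvg (u : nat -> H) (l : H) : Prop :=
  hnorm (u k - l) @[k --> \oo] --> (0 : R).

Definition monotone_op (A : H -> set H) : Prop :=
  forall x y u v : H, A x u -> A y v -> 0 <= ip (x - y) (u - v).

Definition maximally_monotone (A : H -> set H) : Prop :=
  monotone_op A /\
  forall B : H -> set H, monotone_op B ->
    (forall x, A x `<=` B x) -> forall x, B x `<=` A x.

Definition asymptotically_regular (Q : {linear H -> H}) (T : H -> H) : Prop :=
  forall b : H, qnorm Q (iter k.+1 T b - iter k T b) @[k --> \oo] --> (0 : R).

End Hilbert.

Section SetValuedOperators.
Variables (R : realType) (H : vectType R).

Definition zer (A : H -> set H) : set H := [set b | A b 0].

Definition add_op (A : H -> set H) (Q : {linear H -> H}) : H -> set H :=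
  fun a => [set v + Q a | v in A a].

Definition inv_op (B : H -> set H) : H -> set H := fun y => [set x | B x y].

Definition resolvent_rel (A : H -> set H) (Q : {linear H -> H}) : H -> set H :=
  fun b => inv_op (add_op A Q) (Q b).

(* For [A] maximally monotone and [Q] symmetric positive definite,
   [resolvent_rel A Q b] is a singleton for every [b] (Minty), so [a = Tb] iff
   [Qb] belongs to [Aa + Qa], and the default value 0 is never taken. *)
Definition resolvent (A : H -> set H) (Q : {linear H -> H}) : H -> H :=
  fun b => xget 0 (resolvent_rel A Q b).

End SetValuedOperators.

(* Main.v *)
(* In the inner product [f x y := <Qx, y>], the graph [G y w := A y (Q w)] is
   again maximally monotone, so everything reduces to the case [Q = id].
   Totality of [T] (Minty): a point [x] with [G x (b - x)] is a common point of
   the balls [f (x - y) (x - b + w) <= 0], [(y, w)] in [G]. The dual of this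
   feasibility problem is a concave maximization over convex combinations of
   points of [G]; monotonicity makes its value nonpositive, and strong concavity
   makes a maximizing sequence yield the common point.
   Then [T] is firmly nonexpansive: distances to every zero decrease by at least
   the squared step, and the steps themselves decrease, which gives the rate;
   a cluster point of the iterates is a zero by maximality, and being Fejer
   monotone with respect to it the whole sequence converges to it. *)

Require Import Defs.
From HB Require Import structures.
From mathcomp Require Import all_boot all_order all_algebra.
From mathcomp Require Import all_classical all_reals all_analysis.
From mathcomp Require Import ring lra.

Set Implicit Arguments.
Unset Strict Implicit.
Unset Printing Implicit Defensive.

Import Order.TTheory GRing.Theory Num.Theory.
Import numFieldNormedType.Exports.
Import VectorInternalTheory.

Local Open Scope classical_set_scope.
Local Open Scope ring_scope.

(** Replaces passages to the limit; [e <= 1] lets callers bound [e ^+ 2] by 1. *)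
Lemma le0_of_small (R : realType) (a K : R) :
  (forall e, 0 < e <= 1 -> a <= e * K) -> a <= 0.
Proof.
move=> h; rewrite leNgt; apply/negP => a0.
have K0 : 0 < K by move: (h 1); rewrite lexx ltr01 mul1r => /(_ isT); lra.
have dK : 0 < a + K by lra.
(* This choice of [e] makes [e * K] smaller than [a / 2]. *)
have e0 : 0 < a / (2 * (a + K)) by rewrite divr_gt0// mulr_gt0.
have e1 : a / (2 * (a + K)) <= 1 by rewrite ler_pdivrMr ?mulr_gt0//; lra.
move: (h _ (introT andP (conj e0 e1))); rewrite mulrAC ler_pdivlMr ?mulr_gt0//.
by nra.
Qed.

(** A predicate on plain functions, so that the same lemmas serve [ip] and [ip (Q x) y]. *)
Record inner_product (R : realType) (H : vectType R) (f : H -> H -> R) : Prop :=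
  InnerProduct {
    ipDl : forall x y z, f (x + y) z = f x z + f y z;
    ipZl : forall a x z, f (a *: x) z = a * f x z;
    ipC : forall x y, f x y = f y x;
    ip_gt0 : forall x, x != 0 -> 0 < f x x }.

(** * Inner products and compactness in finite dimension *)

Section InnerProduct.
Variables (R : realType) (H : vectType R) (f : H -> H -> R).
Hypothesis fP : inner_product f.

Let fDl := ipDl fP.
Let fZl := ipZl fP.
Let fC := ipC fP.

Lemma ipDr x y z : f z (x + y) = f z x + f z y.
Proof. by rewrite fC fDl !(fC _ z). Qed.

Lemma ipZr a x z : f z (a *: x) = a * f z x.
Proof. by rewrite fC fZl (fC _ z). Qed.

Lemma ipNl x z : f (- x) z = - f x z.
Proof. by rewrite -scaleN1r fZl mulN1r. Qed.

Lemma ipNr x z : f z (- x) = - f z x.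
Proof. by rewrite fC ipNl (fC _ z). Qed.

Lemma ip0l z : f 0 z = 0.
Proof. by rewrite -(scale0r 0) fZl mul0r. Qed.

Definition ipE := (fDl, ipDr, fZl, ipZr, ipNl, ipNr).

Lemma ip_ge0 x : 0 <= f x x.
Proof.
by have [->|/(ip_gt0 fP)/ltW//] := eqVneq x 0; rewrite ip0l.
Qed.

(** Stands in for Cauchy-Schwarz: expand the square of [x + e *: c] and divide by [e]. *)
Lemma ip_small e x c : 0 < e -> f x x <= e ^+ 2 -> - f x c <= e * (1 + f c c).
Proof.
move=> e0 xe; have := ip_ge0 (x + e *: c); have := ip_ge0 c.
rewrite !ipE (fC c x) => c0 h.
have : 0 <= e * (e * (1 + f c c) + 2 * f x c) by nra.
by rewrite pmulr_rge0// => ?; nra.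
Qed.

Lemma ip_parallelogram_le x y : f x x <= 2 * f (x - y) (x - y) + 2 * f y y.
Proof.
have := ip_ge0 (x - 2 *: y); rewrite !ipE (fC y x); lra.
Qed.

Lemma ip_continuous_coord :
  continuous (fun v : 'rV[R]_(dim H) => f (r2v v) (r2v v)).
Proof.
have fsuml (I : Type) (r : seq I) (F : I -> H) z :
    f (\sum_(i <- r) F i) z = \sum_(i <- r) f (F i) z.
  by apply: (big_morph (f ^~ z)) => [x y|]; rewrite ?fDl ?ip0l.
have -> : (fun v : 'rV[R]_(dim H) => f (r2v v) (r2v v)) =
    (fun v => \sum_i \sum_j v 0 i * (v 0 j *
        f (r2v (delta_mx 0 i)) (r2v (delta_mx 0 j)))).
  apply/funext => v; rewrite {1 2}(row_sum_delta v) linear_sum fsuml.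
  apply: eq_bigr => i _; rewrite fC fsuml; apply: eq_bigr => j _.
  by rewrite !linearZ/= !ipE fC mulrCA.
apply: continuous_big => [|i _]; first exact: add_continuous.
apply: continuous_big => [|j _]; first exact: add_continuous.
move=> v; apply: cvgM; [exact: nbhs_filter|exact: coord_continuous|].
by apply: cvgM; [exact: nbhs_filter|exact: coord_continuous|exact: cst_continuous].
Qed.

(** The constants are the extrema of the quadratic form on the compact unit sphere of the coordinate
    norm; homogeneity does the rest. *)
Lemma ip_coord_equiv : exists m M : R, [/\ 0 < m, 0 < M &
  forall v : H, m * `|v2r v| ^+ 2 <= f v v <= M * `|v2r v| ^+ 2].
Proof.
pose S := [set v : 'rV[R]_(dim H) | `|v| = 1].
have Scpt : compact S.
  apply: bounded_closed_compact.
    exists 1; split; first exact: num_real.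
    by move=> x x1 v /= ->; exact: ltW.
  apply: (@preimage_closed 'rV[R]_(dim H) R Num.norm [set x : R | x = 1]).
    by move=> ? _; exact: norm_continuous.
  exact: closed_eq.
have Sunit (v : H) : v != 0 -> S (`|v2r v|^-1 *: v2r v).
  move=> v0; have : `|v2r v| != 0.
    by rewrite normr_eq0 -(inj_eq (@r2v_inj _ _)) v2rK linear0.
  by move=> nv; rewrite /S/= normrZ normfV normr_id mulVf.
(* The sphere is empty only when [H] is the zero space, where any positive constants do. *)
have [S0|S0] := pselect (S !=set0); last first.
  exists 1, 1; split => // v; have [->|/Sunit Sv] := eqVneq v 0.
    by rewrite ip0l linear0 normr0 expr0n mulr0 lexx.
  by case: S0; exists (`|v2r v|^-1 *: v2r v).
have fc := continuous_subspaceT (A := S) ip_continuous_coord.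
have [p pS pm] := EVT_min_rV S0 Scpt fc.
have [q qS qM] := EVT_max_rV S0 Scpt fc.
have pos r : r \in S -> 0 < f (r2v r) (r2v r).
  rewrite inE => Sr; apply: (ip_gt0 fP); apply/eqP => r0.
  move: Sr; rewrite /S/= -(r2vK r) r0 linear0 normr0 => /esym/eqP.
  by rewrite oner_eq0.
exists (f (r2v p) (r2v p)), (f (r2v q) (r2v q)); split; [exact: pos..|].
move=> v; have [->|v0] := eqVneq v 0.
  by rewrite ip0l linear0 normr0 expr0n !mulr0 lexx.
have /mem_set Sv := Sunit _ v0.
have nv : 0 < `|v2r v|.
  by rewrite normr_gt0 -(inj_eq (@r2v_inj _ _)) v2rK linear0.
have := qM _ Sv; have := pm _ Sv; rewrite linearZ/= v2rK !ipE mulrA -expr2.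
rewrite exprVn mulrC ler_pdivlMr ?exprn_gt0// ler_pdivrMr ?exprn_gt0//.
by move=> -> ->.
Qed.

(** Bolzano-Weierstrass, carried over from coordinates by [ip_coord_equiv]. *)
Lemma ip_bounded_cluster (u : nat -> H) (M : R) : (forall k, f (u k) (u k) <= M) ->
  exists l, forall e, 0 < e -> forall N, exists2 k, (N <= k)%N &
    f (u k - l) (u k - l) <= e.
Proof.
have [m [M' [m0 M'0 eqv]]] := ip_coord_equiv => uM.
(* The squared coordinate norm is at most [M / m]; the bound [t <= t ^+ 2 + 1] avoids a square
   root. *)
pose B := [set v : 'rV[R]_(dim H) | `|v| <= M / m + 1].
have Bcpt : compact B.
  apply: bounded_closed_compact.
    exists (M / m + 1); split; first exact: num_real.
    by move=> x x1 v /= /le_trans; apply; exact: ltW.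
  apply: (@preimage_closed 'rV[R]_(dim H) R Num.norm [set x : R | x <= M / m + 1]).
    by move=> ? _; exact: norm_continuous.
  exact: closed_le.
have uB k : B (v2r (u k)).
  have /andP[h _] := eqv (u k); have {h} := le_trans h (uM k).
  rewrite mulrC -ler_pdivlMr// /B/=; move: (M / m) => K hK.
  by have : 0 <= `|v2r (u k)| by []; nra.
have uF : ((v2r \o u) @ \oo) B by exists 0%N => // k _; exact: uB.
have [p [_ clp]] := Bcpt _ (fmap_proper_filter (v2r \o u) _) uF.
exists (r2v p) => e e0 N.
have d0 : 0 < Num.sqrt (e / M') by rewrite sqrtr_gt0 divr_gt0.
have [|_ [[k /= Nk <-] pk]] := clp [set v2r (u k) | k in [set k | N <= k]%N] _ _
    (nbhsx_ballx p _ d0).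
  by exists N => // k /= Nk; exists k.
exists k => //; have /andP[_] := eqv (u k - r2v p) => /le_trans; apply.
rewrite linearB/= r2vK mulrC -ler_pdivlMr//.
rewrite -(sqr_sqrtr (ltW (divr_gt0 e0 M'0))) ler_sqr ?nnegrE ?sqrtr_ge0//.
by move: pk; rewrite -ball_normE /ball_/= distrC => /ltW.
Qed.

End InnerProduct.

(** * Maximally monotone graphs and Minty's theorem *)

Section MonotoneGraph.
Variables (R : realType) (H : vectType R) (f : H -> H -> R).
Hypothesis fP : inner_product f.
Variable G : H -> H -> Prop.
Hypothesis Gmono : forall x u y v, G x u -> G y v -> 0 <= f (x - y) (u - v).
Hypothesis Gmax : forall x u,
  (forall y v, G y v -> 0 <= f (x - y) (u - v)) -> G x u.

Let fE := ipE fP.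
Let fC := ipC fP.

(** The convex hull of the triples [(y, w, f y w)]: [c] averages values of [f] and need not equal
    [f y w]. *)
Inductive graph_hull : H -> H -> R -> Prop :=
| GraphHullPoint y w of G y w : graph_hull y w (f y w)
| GraphHullConv t y w c y' w' c' of 0 <= t <= 1 &
    graph_hull y w c & graph_hull y' w' c' :
    graph_hull ((1 - t) *: y + t *: y') ((1 - t) *: w + t *: w')
      ((1 - t) * c + t * c').

(* Both sides are affine in each of the two triples, so it is enough to check
   this on the graph, where it is monotonicity. *)
Lemma graph_hull_cross y w c y' w' c' :
  graph_hull y w c -> graph_hull y' w' c' -> f y w' + f y' w <= c + c'.
Proof.
move=> h h'; elim: h => {y w c} [y w yw|t y w c y1 w1 c1 /andP[t0 t1] _ h _ h1].
  elim: h' => {y' w' c'} [y' w' yw'|t y' w' c' y1 w1 c1 /andP[t0 t1] _ h _ h1].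
    by have := Gmono yw yw'; rewrite !fE; lra.
  by rewrite !fE; nra.
by rewrite !fE; nra.
Qed.

Section Minty.
Variable b : H.

(** A convex average of the constraint functions [f (x - y) (x - b + w)] is, after completing the
    square, [f (x - mid) (x - mid) + phi]: [mid] is its minimizer in [x] and [phi] its minimum. *)
Let mid y w : H := 2^-1 *: (y + b - w).
Let phi y w c : R := f y b - c - f (mid y w) (mid y w).

(** Crossing a triple with itself gives [f y w <= c], hence [phi] is at most
    [- f (mid - y) (mid - y)]. *)
Lemma dual_value_le0 y w c : graph_hull y w c -> phi y w c <= 0.
Proof.
move=> h; have := graph_hull_cross h h; have := ip_ge0 fP (mid y w - y).
by rewrite /phi /mid !fE (fC b y) (fC w y) (fC w b); lra.
Qed.

(** Strong concavity: [phi] is affine minus the square of [mid], which is affine too. *)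
Lemma dual_value_conv t y w c y' w' c' :
  phi ((1 - t) *: y + t *: y') ((1 - t) *: w + t *: w')
    ((1 - t) * c + t * c') =
  (1 - t) * phi y w c + t * phi y' w' c' +
  t * (1 - t) * f (mid y w - mid y' w') (mid y w - mid y' w').
Proof.
rewrite /phi /mid !fE (fC b y) (fC w y) (fC w b) (fC b y') (fC w' y').
by rewrite (fC w' b) (fC y' y) (fC w' y) (fC w' w) (fC w y'); field.
Qed.

Lemma dual_value_point y w x :
  phi y w (f y w) + f (x - mid y w) (x - mid y w) = f (x - y) (x - b + w).
Proof.
rewrite /phi /mid !fE (fC b y) (fC w y) (fC w b) (fC y x) (fC b x) (fC w x).
by field.
Qed.

(* [phi] is the value of the Lagrangian dual of the search for a point in all
   the balls [f (x - y) (x - b + w) <= 0]; it is strongly concave in [mid], so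
   a cluster point of [mid] along a maximizing sequence solves the problem. *)
Lemma minty : (exists y w, G y w) -> exists x, G x (b - x).
Proof.
move=> [y0 [w0 yw0]].
pose E := [set r | exists y w c, graph_hull y w c /\ r = phi y w c].
have supE : has_sup E.
  split; first by exists (phi y0 w0 (f y0 w0)), y0, w0, (f y0 w0); split => //;
    exact: GraphHullPoint.
  by exists 0 => _ [y [w [c [h ->]]]]; exact: dual_value_le0.
pose s := sup E.
have Es y w c : graph_hull y w c -> phi y w c <= s.
  by move=> h; apply: sup_upper_bound => //; exists y, w, c.
have /choice[p pP] (n : nat) : exists p : H * H * R,
    graph_hull p.1.1 p.1.2 p.2 /\ s - n.+1%:R^-1 < phi p.1.1 p.1.2 p.2.
  have n0 : 0 < n.+1%:R^-1 :> R by rewrite invr_gt0.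
  have [_ [y [w [c [h ->]]]] lt] := sup_adherent n0 supE.
  by exists (y, w, c).
pose x n := mid (p n).1.1 (p n).1.2.
have inv_le1 n : n.+1%:R^-1 <= 1 :> R by rewrite invf_le1// ler1n.
(* Concavity at the midpoint, with both values at least [s - 1], puts [x n] within squared distance
   4 of [x 0]. *)
have xM n : f (x n) (x n) <= 8 + 2 * f (x 0%N) (x 0%N).
  have h2 : 0 <= (2^-1 : R) <= 1 by lra.
  have near_s k : s - 1 <= phi (p k).1.1 (p k).1.2 (p k).2.
    by apply: le_trans (ltW (pP k).2); rewrite lerD2l lerN2.
  have [[gn _] [g0 _]] := (pP n, pP 0%N).
  have := Es _ _ _ (GraphHullConv h2 gn g0).
  rewrite dual_value_conv -/(x n) -/(x 0%N).
  have := near_s n; have := near_s 0%N.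
  by have := ip_parallelogram_le fP (x n) (x 0%N); lra.
have [l lP] := ip_bounded_cluster fP xM.
exists l; apply: Gmax => y w yw.
rewrite (_ : b - l - w = - (l - b + w)); last by rewrite opprD opprB.
rewrite (ipNr fP) oppr_ge0.
(* [c] is the gradient at [l] of the constraint function of [(y, w)]. *)
pose q := mid y w; pose c := 2 *: l - y - b + w.
apply: (@le0_of_small _ _ (3 + 2 * f (l - q) (l - q) + (1 + f c c))) => e.
move=> /andP[e0 e1].
have e20 : 0 < e ^+ 2 by rewrite exprn_gt0.
have [N _ /(_ N (leqnn N)) Ne] := near_infty_natSinv_lt (PosNum e20).
have [n Nn xn] := lP _ e20 N; have [gn pn] := pP n.
have ne : n.+1%:R^-1 <= e ^+ 2.
  by apply: le_trans (ltW Ne); rewrite lef_pV2 ?posrE// ler_nat ltnS.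
have t01 : 0 <= e <= 1 by rewrite ltW.
(* Shifting weight [e] from a triple within [e ^+ 2] of the supremum to the graph point cannot
   exceed [s]. Divided by [e], this bounds the constraint at [x n] by
   [e * (1 + f (x n - q) (x n - q))]. *)
have := Es _ _ _ (GraphHullConv t01 gn (GraphHullPoint yw)).
rewrite dual_value_conv -/(x n) -/q.
have := dual_value_point y w (x n); rewrite -/q.
have := ip_parallelogram_le fP (x n - q) (l - q).
have -> : x n - q - (l - q) = x n - l by rewrite opprB addrA subrK.
have := ip_small fP c e0 xn.
have gE u : f (u - y) (u - b + w) =
    f (l - y) (l - b + w) + f (u - l) c + f (u - l) (u - l).
  by rewrite /c !fE (fC l u) (fC y u) (fC y l); ring.
have := ip_ge0 fP (x n - l).
have := dual_value_le0 gn.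
rewrite gE; set a := phi _ _ _ in pn *; set D := f (x n - q) _.
set d := f (x n - l) (x n - l) in xn *; move=> a0 d0 k0 Dd bD conv.
have d1 : d <= 1 by apply: le_trans xn _; rewrite expr_le1// ltW.
have sa : s - e ^+ 2 <= a by apply: le_trans (ltW pn); rewrite lerD2l lerN2.
have : e * (phi y w (f y w) + D - a) <= e * (e * (1 + D)) by lra.
rewrite ler_pM2l// bD; have : e * D <= e * (2 + 2 * f (l - q) (l - q)).
  by rewrite ler_pM2l//; lra.
by lra.
Qed.

End Minty.

(** * Iterates of the resolvent: Fejer monotonicity, rate and convergence *)

Section Resolvent.
Variables (T : H -> H) (z : H).
Hypothesis TG : forall b, G (T b) (b - T b).
Hypothesis zG : G z 0.

Lemma resolvent_nonexpansive x y :
  f (T x - T y) (T x - T y) <= f (x - y) (x - y).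
Proof.
have := Gmono (TG x) (TG y); have := ip_ge0 fP ((x - T x) - (y - T y)).
set d := T x - T y; have -> : x - T x - (y - T y) = (x - y) - d.
  by rewrite /d !opprB [T y - y]addrC addrACA [- T x + _]addrC.
by move: (x - y) d => u d; rewrite !fE (fC u d); lra.
Qed.

(** The cross term of the expanded square has a sign by monotonicity between [(T x, x - T x)] and
    [(v, 0)]. *)
Lemma resolvent_fejer v x : G v 0 ->
  f (T x - v) (T x - v) + f (T x - x) (T x - x) <= f (x - v) (x - v).
Proof.
move=> vG; have := Gmono (TG x) vG; rewrite subr0.
have -> : x - v = (T x - v) - (T x - x) by rewrite opprB [RHS]addrC addrA subrK.
rewrite -[x - T x]opprB; move: (T x - v) (T x - x) => u d.
by rewrite !fE (fC d u); lra.
Qed.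

Variable b : nat -> H.
Hypothesis bT : forall k, b k.+1 = T (b k).

Lemma resolvent_fejer_dist v k : G v 0 ->
  f (b k.+1 - v) (b k.+1 - v) <= f (b k - v) (b k - v).
Proof.
move=> vG; rewrite bT; have := resolvent_fejer (b k) vG.
by have := ip_ge0 fP (T (b k) - b k); lra.
Qed.

(** The Fejer inequalities telescope, and since steps do not grow, the last one can replace each of
    the [k.+1] summands. *)
Lemma resolvent_rate v k : G v 0 ->
  f (b k.+1 - b k) (b k.+1 - b k) *+ k.+1 <= f (b 0%N - v) (b 0%N - v).
Proof.
move=> vG; have step j : f (b j.+2 - b j.+1) (b j.+2 - b j.+1) <=
    f (b j.+1 - b j) (b j.+1 - b j).
  by have := resolvent_nonexpansive (b j.+1) (b j); rewrite -!bT.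
(* The remaining distance to [v] is kept so that the induction closes. *)
suff : f (b k.+1 - b k) (b k.+1 - b k) *+ k.+1 +
    f (b k.+1 - v) (b k.+1 - v) <= f (b 0%N - v) (b 0%N - v).
  by have := ip_ge0 fP (b k.+1 - v); lra.
elim: k => [|k IH].
  by rewrite mulr1n addrC bT; exact: resolvent_fejer.
have := resolvent_fejer (b k.+1) vG; rewrite -bT mulrS.
by have := ler_wMn2r k.+1 (step k); lra.
Qed.

Lemma resolvent_cvg : exists2 l, G l 0 &
  forall e, 0 < e -> exists N, forall k, (N <= k)%N -> f (b k - l) (b k - l) <= e.
Proof.
have bz k : f (b k - z) (b k - z) <= f (b 0%N - z) (b 0%N - z).
  by elim: k => // k IH; apply: le_trans IH; exact: resolvent_fejer_dist.
have bM k : f (b k) (b k) <= 2 * f (b 0%N - z) (b 0%N - z) + 2 * f z z.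
  by have := ip_parallelogram_le fP (b k) z; have := bz k; lra.
have [l lP] := ip_bounded_cluster fP bM.
(* Once [l] is a zero, a single close iterate suffices: later ones are no farther from [l]. *)
have lG : G l 0; last first.
  exists l => // e e0; have [N _ Ne] := lP e e0 0%N.
  exists N; elim=> [|k IH]; first by rewrite leqn0 => /eqP <-.
  rewrite leq_eqVlt => /predU1P[<-//|/IH]; apply: le_trans.
  exact: resolvent_fejer_dist.
apply: Gmax => y w yw; rewrite sub0r (ipNr fP) oppr_ge0.
pose K := f (b 0%N - z) (b 0%N - z); have K0 : 0 <= K by exact: ip_ge0.
apply: (@le0_of_small _ _ (4 + f w w + 2 * f (l - y) (l - y))) => e.
move=> /andP[e0 e1]; have e20 : 0 < e ^+ 2 by rewrite exprn_gt0.
have eK : 0 < e ^+ 2 / (K + 1) by rewrite divr_gt0//; lra.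
have [N _ /(_ N (leqnn N)) Ne] := near_infty_natSinv_lt (PosNum eK).
(* An index beyond [N] is some [m = k.+1] with [N <= k]: [b m] is then [T (b k)], and the step [d]
   is small by the rate. *)
have [[//|k] Nk kl] := lP _ e20 N.+1; set m := k.+1 in kl.
pose d := b m - b k.
have de : f d d <= e ^+ 2.
  have := resolvent_rate k zG; rewrite -/m -/d -/K -mulr_natr.
  rewrite -ler_pdivlMr// => /le_trans; apply.
  move: Ne; rewrite /= ltr_pdivlMr ?ltr_wpDl// => /ltW Ne.
  apply: le_trans Ne; rewrite mulrC ler_pM ?invr_ge0// ?lerDl//.
  by rewrite lef_pV2 ?posrE// ler_nat.
have := Gmono (TG (b k)) yw; rewrite -bT -/m -[b k - b m]opprB -/d.
have -> : b m - y = (b m - l) + (l - y) by rewrite addrA subrK.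
have := ip_small fP w e0 kl.
have := ip_small fP ((b m - l) + (l - y)) e0 de.
have := ip_parallelogram_le fP ((b m - l) + (l - y)) (l - y).
rewrite addrK; move: kl; set u := b m - l; set v := l - y => ue uv dv uw.
rewrite (ipDr fP) 2!(ipNr fP) [f (u + v) d]fC [f (u + v) w](ipDl fP) => h.
have u1 : f u u <= 1 by apply: le_trans ue _; rewrite expr_le1// ltW.
have : e * f (u + v) (u + v) <= e * (2 + 2 * f v v) by rewrite ler_pM2l//; lra.
by lra.
Qed.

End Resolvent.
End MonotoneGraph.

(** * Transfer to the inner product defined by [Q] *)

Section ResolventOperator.
Variables (R : realType) (H : vectType R) (ip : {dot H for idfun}).

Lemma dot_inner_product : inner_product (ip : H -> H -> R).
Proof.
split=> [x y z|a x z|x y|x x0].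
- by rewrite linearDl.
- by rewrite linearZl_LR.
- by rewrite hermC expr0 mul1r.
- exact: neq0_dnorm_gt0.
Qed.

Variables (Q : {linear H -> H}).
Hypotheses (Qsym : symmetric_op ip Q) (Qpos : posdef_op ip Q).

Let f x y : R := ip (Q x) y.

Lemma posdef_inner_product : inner_product f.
Proof.
have iP := dot_inner_product; split=> [x y z|a x z|x y|]; last exact: Qpos.
- by rewrite /f linearD (ipDl iP).
- by rewrite /f linearZ (ipZl iP).
- by rewrite /f Qsym (ipC iP).
Qed.

(** Positive definiteness makes [Q] injective, hence bijective in finite dimension. *)
Lemma posdef_op_surj v : exists w, Q w = v.
Proof.
have kQ : lker (linfun Q) == 0%VS.
  apply/lker0P => x y; rewrite !lfunE/= => xy; apply/eqP; rewrite -subr_eq0.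
  apply/negPn/negP => /Qpos; rewrite (linearB Q) xy/= subrr.
  by rewrite (ip0l dot_inner_product) ltxx.
by exists ((linfun Q)^-1%VF v); rewrite -[Q _]lfunE lker0_lfunVK.
Qed.

Variable A : H -> set H.
Hypothesis Amax : maximally_monotone ip A.

Let G y w := A y (Q w).

Lemma monotone_graph x u y v : G x u -> G y v -> 0 <= f (x - y) (u - v).
Proof. by move=> xu yv; rewrite /f Qsym (linearB Q); exact: Amax.1. Qed.

(** Adding the single point [(x, Q u)] to [A] keeps it monotone, as surjectivity of [Q] lets the
    hypothesis reach every value of [A]. *)
Lemma maximal_graph x u : (forall y v, G y v -> 0 <= f (x - y) (u - v)) -> G x u.
Proof.
move=> xu; pose B y := A y `|` [set v | y = x /\ v = Q u].
have xuA y v : A y v -> 0 <= ip (x - y) (Q u - v).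
  by have [w <-] := posdef_op_surj v => /xu; rewrite /f Qsym (linearB Q).
apply: (Amax.2 B) => [y y' v v'|y v yv|]; [|by left|by right].
case=> [yv|[-> ->]] [yv'|[-> ->]].
- exact: Amax.1.
- have := xuA _ _ yv.
  by rewrite -[y - x]opprB -[v - _]opprB linearNl linearN opprK.
- exact: xuA.
- by rewrite subrr (ip0l dot_inner_product).
Qed.

Lemma resolventP : zer A !=set0 ->
  forall b, A (resolvent A Q b) (Q (b - resolvent A Q b)).
Proof.
move=> [z zA] b; rewrite /resolvent; case: xgetP => [x _|nx].
  by move=> [v xv vE]; rewrite linearB -vE addrK.
(* Minty's point rules out the default value of [xget]. *)
have [|x xG] := minty posdef_inner_product monotone_graph maximal_graph b.
  by exists z, 0; rewrite /G linear0.
by case: (nx x); exists (Q (b - x)) => //; rewrite linearB subrK.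
Qed.

End ResolventOperator.

(** * Return to norms and conclusion *)

Lemma cvg_sqrt0 (R : realType) (u : nat -> R) :
  (forall e, 0 < e -> exists N, forall k, (N <= k)%N -> u k <= e) ->
  Num.sqrt (u k) @[k --> \oo] --> (0 : R).
Proof.
move=> us; apply/cvgr0Pnorm_le => e e0.
have [N uN] := us (e ^+ 2) (exprn_gt0 2 e0); exists N => // k /uN ue.
by rewrite ger0_norm// (le_trans (ler_wsqrtr ue))// sqrtr_sqr ger0_norm// ltW.
Qed.

Theorem proposition3p1 (R : realType) (H : vectType R) (ip : {dot H for idfun})
    (A : H -> set H) (Q : {linear H -> H}) (b0 : H) (b : nat -> H)
    (hA : maximally_monotone ip A)
    (hzer : zer A !=set0)
    (hb0 : b 0%N = b0)
    (hb : forall k : nat, b k.+1 = resolvent A Q (b k))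
    (hQsym : symmetric_op ip Q)
    (hQpos : posdef_op ip Q) :
  asymptotically_regular ip Q (resolvent A Q) /\
  exists bstar : H,
    [/\ zer A bstar,
        hcvg ip b bstar &
        forall k : nat,
          qnorm ip Q (b k.+1 - b k)
            <= 1 / Num.sqrt (k.+1%:R : R) * qnorm ip Q (b0 - bstar)].
Proof.
have iP := dot_inner_product ip.
have fP := posdef_inner_product hQsym hQpos.
have Gmono := monotone_graph hQsym hA.
have Gmax := maximal_graph hQsym hQpos hA.
have TG := resolventP hQsym hQpos hA hzer.
have [z zA] := hzer.
have zG : A z (Q 0) by rewrite linear0.
split.
  move=> c; apply: cvg_sqrt0 => e e0.
  pose K := ip (Q (c - z)) (c - z); have K0 : 0 <= K by exact: ip_ge0 fP _.
  have eK : 0 < e / (K + 1) by rewrite divr_gt0//; lra.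
  have [N _ Ne] := near_infty_natSinv_lt (PosNum eK).
  exists N => k /Ne/ltW /=; rewrite ler_pdivlMr ?ltr_wpDl// => ke.
  have := resolvent_rate fP Gmono TG (b := fun k => iter k (resolvent A Q) c)
    (fun=> erefl) k zG.
  rewrite -mulr_natr -ler_pdivlMr// => /le_trans; apply; apply: le_trans ke.
  by rewrite mulrC ler_wpM2l ?invr_ge0// lerDl.
have [l lG lcvg] := resolvent_cvg fP Gmono Gmax TG zG hb.
exists l; split; first by move: lG; rewrite linear0.
(* Both inner products are compared with the coordinate norm, so [e / M * m] in the [Q] square
   yields [e] in the Hilbert square. *)
- have [m [? [m0 _ fm]]] := ip_coord_equiv fP.
  have [? [M [_ M0 gM]]] := ip_coord_equiv iP.
  apply: cvg_sqrt0 => e e0.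
  have [|N lN] := lcvg (e / M * m); first by rewrite mulr_gt0 ?divr_gt0.
  exists N => k /lN; have /andP[+ _] := fm (b k - l) => /le_trans /[apply].
  rewrite mulrC ler_pM2r// ler_pdivlMr// mulrC; apply: le_trans.
  by have /andP[] := gM (b k - l).
- move=> k; rewrite /qnorm -hb0 div1r -sqrtrV// -sqrtrM ?invr_ge0//.
  rewrite ler_wsqrtr// mulrC ler_pdivlMr// mulr_natr.
  exact: (resolvent_rate fP Gmono TG hb k lG).
Qed.
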